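(* Let $p,q$ be distinct primes, let $\alpha\geq 1$, $\beta\geq 1$ be integers, and let $G=P\rtimes Q$ be a Schmidt group of order $p^{\alpha}q^{\beta}$, where $P$ is the normal Sylow $p$-subgroup of $G$ and $Q$ is a cyclic Sylow $q$-subgroup of $G$. If $G$ is a $\mathcal{B}_{\psi}$-group, then $P$ is a special $p$-group of order $p^{\alpha}$, $Q\cong C_q$ (that is, $\beta=1$), and $p<q$. Conversely, let $G=P\rtimes Q$ be a Schmidt group of order $p^{\alpha}q$, where $\alpha\ge 1$, $P$ is the normal Sylow $p$-subgroup of $G$ and is a special $p$-group, $Q\cong C_q$, and $p,q$ are primes with $p<q$. Let $r$ be the multiplicative order of $p$ modulo $q$. Then: (i) if $P$ is abelian, then $G$ is a $\mathcal{B}_{\psi}$-group; (ii) if $P$ is non-abelian, $p$ is odd, and the inequality $$(p^{\alpha-r+1}-p+1)(q^2-q+1)<p^{\alpha}q$$ holds, then $G$ is a $\mathcal{B}_{\psi}$-group; (iii) if $P$ is non-abelian, $p=2$, and the inequalities $$(p^{\alpha-r+1}-p+1)(q^2-q+1)<p^{\alpha}q\quad\text{(with } p=2\text{)}\qquad\text{and}\qquad \psi(P)<2^{\alpha}q$$ hold, then $G$ is a $\mathcal{B}_{\psi}$-group.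
   Context: For a finite group $H$, let $\psi(H)=\sum_{x\in H}o(x)$ be the sum of the orders of all elements of $H$, where $o(x)$ is the order of $x$. A finite group $G$ is called a $\mathcal{B}_{\psi}$-group if $\psi(H)<|G|$ for every proper subgroup $H$ of $G$. $C_n$ denotes the cyclic group of order $n$. A Schmidt group is a finite minimal non-nilpotent group, i.e. a finite non-nilpotent group all of whose proper subgroups are nilpotent. It is a known fact that the order of a Schmidt group has exactly two prime divisors $p,q$, and that it is a semidirect product $G=P\rtimes Q$ of a normal Sylow $p$-subgroup $P$ and a cyclic Sylow $q$-subgroup $Q$; the notation $G=P\rtimes Q$ refers to this decomposition. A special $p$-group is a finite $p$-group $P$ that is either elementary abelian, or non-abelian with $Z(P)=P'=\Phi(P)$ elementary abelian, where $Z(P)$, $P'$, $\Phi(P)$ are the center, the derived subgroup and the Frattini subgroup of $P$. *)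

(* Defs.v *)
From mathcomp Require Import all_boot all_order all_fingroup all_solvable all_algebra.

Set Implicit Arguments.
Unset Strict Implicit.
Unset Printing Implicit Defensive.

Section Defs.

Variable gT : finGroupType.

Definition psi (H : {set gT}) : nat := \sum_(x in H) #[x]%g.

Definition Bpsi_group (G : {group gT}) : Prop :=
  forall H : {group gT}, H \proper G -> psi H < #|G|.

Definition schmidt_group (G : {group gT}) : Prop :=
  ~~ nilpotent G /\ (forall H : {group gT}, H \proper G -> nilpotent H).

(* The library's [special P] is 'Phi(P) = 'Z(P) /\ P^`(1) = 'Z(P); a nontrivial
   elementary abelian group does not satisfy it, hence the first disjunct. *)
Definition special_pgroup (p : nat) (P : {group gT}) : Prop :=
  (p.-abelem P \/
   [/\ p.-group P, ~~ abelian P, special P & p.-abelem 'Z(P)])%g.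

Definition schmidt_sdprod (p q : nat) (G P Q : {group gT}) : Prop :=
  [/\ schmidt_group G, p.-Sylow(G) P /\ P <| G,
      q.-Sylow(G) Q /\ cyclic Q & P ><| Q = G]%g.

End Defs.

(* Main.v *)
(* psi is multiplicative on direct products of coprime groups.  In a Schmidt
   group, Q centralises every proper Q-invariant subgroup of P but not P itself;
   coprime action then gives [P, Q] = P, so P is special and 'C_P(Q) is
   elementary abelian (trivial or equal to 'Z(P)).

   If G is a B_psi-group, the test subgroup P x <y^q>, where Q = <y>, rules out
   beta > 1, and P itself then gives p < q.  Conversely, a proper subgroup is
   nilpotent, so it lies in P or is conjugate to A x Q with A <= 'C_P(Q).  The
   congruence |P| = |'C_P(Q)| mod q forces |'C_P(Q)| <= p ^ (alpha - r). *)

Require Import Defs.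
From mathcomp Require Import all_boot all_order all_fingroup all_solvable all_algebra.
From mathcomp Require Import zify ring.

Set Implicit Arguments.
Unset Strict Implicit.
Unset Printing Implicit Defensive.

(** * Sums of element orders: products, exact values and lower bounds *)

Section Psi.

Local Open Scope group_scope.

Variable gT : finGroupType.
Implicit Types (A B C H : {group gT}) (p q : nat).

Lemma psi_subset A B : A \subset B -> psi A <= psi B.
Proof.
move=> sAB; rewrite /psi [leqRHS](big_setID A) /= (setIidPr sAB).
exact: leq_addr.
Qed.

Lemma psi_conj A x : psi (A :^ x) = psi A.
Proof.
rewrite /psi big_imset /=; last by move=> y z _ _; apply: conjg_inj.
by apply: eq_bigr => y _; rewrite orderJ.
Qed.

Lemma psi_dprod A B H :
  A \x B = H -> coprime #|A| #|B| -> psi H = (psi A * psi B)%N.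
Proof.
move=> defH coAB; have [_ defAB cAB tiAB] := dprodP defH.
(* Since [A] and [B] meet trivially, multiplication is a bijection from pairs onto [H], which
   reindexes the sum; orders of commuting elements of coprime order multiply. *)
have -> : H = mulg @2: (A, B) :> {set gT} by rewrite -defAB.
rewrite curry_imset2X /psi big_imset /=; last first.
  move=> [x y] [x' y'] /setXP[/= Ax By] /setXP[/= Ax' By'] eq_xy.
  have eq_x : x = x'.
    by rewrite -(divgrMid tiAB Ax By) -(divgrMid tiAB Ax' By') eq_xy.
  by move: eq_xy; rewrite eq_x => /mulgI ->.
rewrite big_distrl /=; under [RHS]eq_bigr do rewrite big_distrr /=.
rewrite pair_big_dep /=; apply: eq_big => [[x y]|[x y] /setXP[/= Ax By]].
  by rewrite in_setX.
apply: orderM; first exact: commute_sym (centsP cAB _ By _ Ax).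
exact: coprime_dvdl (order_dvdG Ax) (coprime_dvdr (order_dvdG By) coAB).
Qed.

Lemma psi_prime_exponent p A :
  prime p -> exponent A %| p -> psi A = (1 + p * #|A|.-1)%N.
Proof.
move=> p_pr /exponentP expA.
rewrite /psi (big_setD1 1) //= order1 (cardsD1 1 A) group1 /= mulnC.
rewrite -sum_nat_const; congr addn; apply: eq_bigr => x /setD1P[ntx Ax].
by apply: nt_prime_order => //; apply: expA.
Qed.

Lemma psi_pgroup_ge p A :
  prime p -> p.-group A -> 1 + p * #|A|.-1 <= psi A.
Proof.
move=> p_pr pA.
rewrite /psi (big_setD1 1) //= order1 (cardsD1 1 A) group1 /= mulnC.
rewrite -sum_nat_const leq_add2l leq_sum // => x /setD1P[ntx Ax].
have ntcx : <[x]> != 1 by rewrite cycle_eq1.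
by have [_ p_dvd _] := pgroup_pdiv (mem_p_elt pA Ax) ntcx; apply: dvdn_leq.
Qed.

(** Only the generators are counted. *)
Lemma psi_cyclic_ge C : cyclic C -> totient #|C| * #|C| <= psi C.
Proof.
case/cyclicP=> a defC; rewrite defC -/(order a) totient_gen.
have sub : [set x | generator <[a]> x] \subset <[a]>.
  by apply/subsetP=> x; rewrite inE => /cycle_generator.
rewrite /psi -sum_nat_const.
rewrite [leqRHS](big_setID [set x | generator <[a]> x]) /= (setIidPr sub).
rewrite -[leqLHS]addn0 leq_add // leq_sum // => x.
by rewrite inE => /eqP; rewrite /order => ->.
Qed.

(** The factor 2/3 is chosen to cancel against the bound [psi P] >= (3/2)[#|P|] for a nontrivial
    [p]-group. *)
Lemma psi_cyclic_pgroup_ge q n C :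
    prime q -> cyclic C -> #|C| = (q ^ n.+1)%N ->
  2 * (#|C| * q) <= 3 * psi C.
Proof.
move=> q_pr cC oC; have q_gt1 := prime_gt1 q_pr.
case: n => [|n] in oC *.
  (* In prime order the generator count is too weak for [q = 2], so the exact value is used. *)
  rewrite (@psi_prime_exponent q) ?oC ?expn1 //; last first.
    by rewrite -[q in _ %| q]expn1 -oC exponent_dvdn.
  by case: q q_gt1 {q_pr oC} => [|[|m]] // _; nia.
apply: leq_trans (leq_mul (leqnn 3) (psi_cyclic_ge cC)).
rewrite oC totient_pfactor //= mulnCA [leqRHS]mulnA [leqRHS]mulnC leq_mul2l.
apply/orP; right; rewrite mulnA expnS.
have : 0 < q ^ n by rewrite expn_gt0 ltnW.
move: (q ^ n)%N => m; case: q q_gt1 {q_pr oC} => [|[|k]] // _.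
by rewrite /=; nia.
Qed.

End Psi.

(** * Structure and proper subgroups of a Schmidt group *)

Section Schmidt.

Local Open Scope group_scope.

Variables (gT : finGroupType) (G P Q : {group gT}) (p q : nat).
Hypotheses (p_pr : prime p) (q_pr : prime q) (neq_pq : p != q).
Hypothesis schG : schmidt_sdprod p q G P Q.

Local Lemma sylP : p.-Sylow(G) P. Proof. by case: schG => _ [? ?] [? ?] _. Qed.
Local Lemma sylQ : q.-Sylow(G) Q. Proof. by case: schG => _ [? ?] [? ?] _. Qed.
Local Lemma nsPG : P <| G. Proof. by case: schG => _ [? ?] [? ?] _. Qed.
Local Lemma defG : P ><| Q = G. Proof. by case: schG. Qed.
Local Lemma nilH (H : {group gT}) : H \proper G -> nilpotent H.
Proof. by case: schG => [[_ nil]] _ _ _; apply: nil. Qed.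

Let pP : p.-group P := pHall_pgroup sylP.
Let qQ : q.-group Q := pHall_pgroup sylQ.
Let sPG : P \subset G := pHall_sub sylP.
Let sQG : Q \subset G := pHall_sub sylQ.

Local Lemma nPQ : Q \subset 'N(P).
Proof. exact: subset_trans sQG (normal_norm nsPG). Qed.

Lemma coprime_pq_groups (A B : {group gT}) :
  p.-group A -> q.-group B -> coprime #|A| #|B|.
Proof.
move=> pA qB; apply: pnat_coprime pA (pi_pnat qB _).
by rewrite !inE eq_sym.
Qed.

Local Lemma coPQ : coprime #|P| #|Q|. Proof. exact: coprime_pq_groups. Qed.

Lemma schmidt_not_cents : ~~ (P \subset 'C(Q)).
Proof.
apply/negP=> cPQ; case: schG => [[/negP nnilG _]] _ _ _; apply: nnilG.
have defG' : P \x Q = G.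
  by have [_ mulPQ _ tiPQ] := sdprodP defG; rewrite dprodE 1?centsC.
by rewrite (dprod_nil defG') (pgroup_nil pP) (pgroup_nil qQ).
Qed.

(** [R <*> Q] is a proper subgroup, hence nilpotent, and subgroups of coprime order in a nilpotent
    group commute. *)
Lemma schmidt_cents_proper (R : {group gT}) :
  R \proper P -> Q \subset 'N(R) -> R \subset 'C(Q).
Proof.
move=> prR nRQ; have sRP := proper_sub prR.
have co : coprime #|Q| #|R|.
  by rewrite coprime_sym (coprime_pq_groups _ qQ) ?(pgroupS sRP).
have prH : R <*> Q \proper G.
  rewrite properEcard join_subG (subset_trans sRP) //= sQG.
  rewrite norm_joinEr // coprime_cardMg 1?coprime_sym // -(sdprod_card defG).
  by rewrite ltn_pmul2r ?cardG_gt0 // proper_card.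
by apply: (sub_nilpotent_cent2 (nilH prH)); rewrite ?joing_subl ?joing_subr.
Qed.

(** Otherwise [Q] would centralise both the proper subgroup [[~: P, Q]] and the quotient by it; by
    coprime action it would then centralise [P]. *)
Lemma schmidt_commg : [~: P, Q] = P.
Proof.
apply/eqP; apply/idPn=> neqR; have nPQ := nPQ.
have sRP : [~: P, Q] \subset P by rewrite commg_subl.
have prR : [~: P, Q] \proper P by rewrite properEneq neqR.
have nRQ := commg_normr Q P.
have cRQ := schmidt_cents_proper prR nRQ.
case/negP: schmidt_not_cents.
have sRC : [~: P, Q] \subset 'C_P(Q) by rewrite subsetI sRP.
have := coprime_quotient_cent sRP nRQ coPQ (pgroup_sol pP).
have cPQR : P / [~: P, Q] \subset 'C(Q / [~: P, Q]).
  by rewrite quotient_cents2r.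
rewrite /= (setIidPl cPQR) => eqCP.
have : P \subset 'C_P(Q).
  rewrite -(quotientSGK _ sRC) ?commg_norml //=.
  by rewrite eqCP.
by rewrite subsetI subxx.
Qed.

Lemma schmidt_neq1 : P :!=: 1.
Proof. by apply: contra schmidt_not_cents => /eqP->; apply: sub1G. Qed.

Lemma schmidt_char_cents (R : {group gT}) :
  R \char P -> R \proper P -> R \subset 'C(Q).
Proof.
move=> chR prR; apply: schmidt_cents_proper => //.
exact: char_norm_trans chR nPQ.
Qed.

Lemma schmidt_abelian : abelian P -> 'C_P(Q) = 1.
Proof.
by move=> abP; rewrite -{1}schmidt_commg coprime_abel_cent_TI ?coPQ ?nPQ.
Qed.

(** The Frattini subgroup is proper and characteristic, so it lies in ['C_P(Q)], which is trivial
    here. *)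
Lemma schmidt_abelem : abelian P -> p.-abelem P.
Proof.
move=> abP; rewrite -(trivg_Phi pP) -subG1 -(schmidt_abelian abP) subsetI.
by rewrite Phi_sub schmidt_char_cents ?Phi_char ?Phi_proper ?schmidt_neq1.
Qed.

(** Every characteristic abelian subgroup of [P] is proper, hence centralised by [Q]; this is the
    hypothesis of the coprime-action criterion for special groups. *)
Lemma schmidt_nonabelian : ~~ abelian P -> special P /\ 'C_P(Q) = 'Z(P).
Proof.
move=> nabP; apply: abelian_charsimple_special pP coPQ schmidt_commg _.
apply/bigcupsP=> R /andP[chR abR]; apply: schmidt_char_cents => //.
rewrite properEneq char_sub // andbT.
by apply: contraNneq nabP => <-.
Qed.

Lemma schmidt_special : special_pgroup p P.
Proof.
have [abP | nabP] := boolP (abelian P); first by left; apply: schmidt_abelem.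
have [spP _] := schmidt_nonabelian nabP.
by right; split=> //; apply: center_special_abelem.
Qed.

Lemma schmidt_subcent_abelem : p.-abelem 'C_P(Q).
Proof.
have [abP | nabP] := boolP (abelian P).
  by rewrite schmidt_abelian ?abelem1.
have [spP ->] := schmidt_nonabelian nabP.
exact: center_special_abelem.
Qed.

(* In class 2 with odd p, powering by p is an endomorphism of P; its values lie
   in 'Phi(P), on which Q acts trivially, so it kills [P, Q] = P. *)
Lemma schmidt_odd_exponent : odd p -> exponent P %| p.
Proof.
move=> p_odd; have [abP | nabP] := boolP (abelian P).
  by case/and3P: (schmidt_abelem abP).
have [spP defC] := schmidt_nonabelian nabP; have [defPhi defP'] := spP.
have /and3P[_ _ /exponentP expZ] := center_special_abelem pP spP.
have fM : {in P &, {morph (fun x : gT => x ^+ p) : x y / x * y}}.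
  move=> y x Py Px /=.
  have Zxy : [~ x, y] \in 'Z(P) by rewrite -defP' mem_commg.
  have /centP cZ := subsetP (subsetIr _ _) _ Zxy.
  rewrite expMg_Rmul; [|exact/commute_sym/cZ..].
  (* Oddness gives 2 < [p], so the exponent of the commutator factor is a multiple of [p], and that
     factor lies in ['Z(P)], of exponent dividing [p]. *)
  have /dvdnP[m ->] : p %| 'C(p, 2).
    rewrite prime_dvd_bin //= ltn_neqAle prime_gt1 // andbT.
    by apply: contraTneq p_odd => <-.
  by rewrite mulnC expgM (expZ _ Zxy) expg1n mulg1.
have sP : P \subset 'ker (Morphism fM).
  rewrite -{1}schmidt_commg gen_subG; apply/subsetP=> _ /imset2P[x a Px Qa ->].
  have Pxa : x ^ a \in P by rewrite memJ_norm // (subsetP nPQ).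
  have Pp : x ^+ p \in 'C(Q).
    suff : x ^+ p \in 'C_P(Q) by case/setIP.
    rewrite defC -defPhi (Phi_joing pP) (MhoE 1 pP) joing_idr mem_gen //.
    by rewrite inE orbC (imset_f (fun x => x ^+ (p ^ 1))).
  apply/kerP; first by rewrite commgEl groupM ?groupV.
  rewrite commgEl /= fM ?groupV // expVgn -conjXg conjgE (centP Pp _ Qa).
  by rewrite mulKg mulVg.
by apply/exponentP=> x Px; have /mker := subsetP sP x Px.
Qed.

Lemma schmidt_subcent_proper : 'C_P(Q) \proper P.
Proof.
rewrite properE subsetIl /=; apply: contra schmidt_not_cents => sPC.
exact: subset_trans sPC (subsetIr _ _).
Qed.

(** ['C_P(Q)] is the set of fixed points of the [q]-group [Q] acting on [P] by conjugation. *)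
Lemma schmidt_card_mod : q %| #|P| - #|'C_P(Q)|.
Proof.
rewrite -eqn_mod_dvd ?subset_leq_card ?subsetIl //.
have aQ : [acts Q, on P | 'J] by rewrite astabsJ nPQ.
by rewrite (pgroup_fix_mod qQ aQ) afixJ.
Qed.

Lemma schmidt_psi_proper (H : {group gT}) :
    #|Q| = q -> H \proper G ->
  H \subset P \/ psi H <= psi 'C_P(Q) * psi Q.
Proof.
move=> oQ prH; have sHG := proper_sub prH.
have [sHP | nsHP] := boolP (H \subset P); [by left | right].
have [R sylR] := Sylow_exists q H; have sRH := pHall_sub sylR.
have [x Gx sRxQ] :=
  Sylow_Jsub sylQ (subset_trans sRH sHG) (pHall_pgroup sylR).
have Q_H : Q \subset H :^ x.
  suff <- : R :^ x = Q by rewrite conjSg.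
  apply/eqP; rewrite eqEcard sRxQ cardJg oQ.
  (* A Sylow [q]-subgroup of [H] with fewer than [q] elements is trivial; then [#|H|] is prime to
     [q], so it divides [#|P|] and [H] lies in [P]. *)
  apply: contraR nsHP; rewrite -ltnNge (sub_normal_Hall sylP nsPG sHG).
  have [n oR] := p_natP (pHall_pgroup sylR); rewrite oR => lt_q.
  have n0 : n = 0%N.
    case: (n) lt_q => // m.
    by rewrite ltnNge expnS leq_pmulr ?expn_gt0 ?prime_gt0.
  have q'H : coprime #|H| q.
    rewrite coprime_sym prime_coprime // -p'natE // -partn_eq1 //.
    by rewrite -(card_Hall sylR) oR n0.
  apply: pnat_dvd pP; rewrite -(Gauss_dvdl _ q'H) -oQ (sdprod_card defG).
  exact: cardSg.
rewrite -(psi_conj H x).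
have prHx : (H :^ x)%G \proper G by rewrite -(conjGid Gx) properJ.
have coPHx : coprime #|P :&: H :^ x| #|Q|.
  by apply: coprime_pq_groups => //; apply: pgroupS (subsetIl _ _) pP.
(* Nilpotency makes the two factors commute, and the modular law shows that they generate. *)
have defHx : (P :&: H :^ x) \x Q = H :^ x.
  have sPHx : P :&: H :^ x \subset H :^ x := subsetIr _ _.
  have cPHx : Q \subset 'C(P :&: H :^ x).
    by apply: (sub_nilpotent_cent2 (nilH prHx)); rewrite ?coPHx.
  have [_ mulPQ _ tiPQ] := sdprodP defG.
  rewrite dprodE //; last by rewrite setIAC tiPQ setI1g.
  by rewrite [gval _]setIC group_modr // mulPQ (setIidPl (proper_sub prHx)).
rewrite (psi_dprod defHx) // leq_mul2r psi_subset ?orbT // subsetI subsetIl.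
by case/dprodP: defHx => _ _; rewrite centsC.
Qed.
(** [P <*> K] is proper, hence nilpotent, hence a coprime direct product. It is used with [K] of
    index [q] in [Q], and with [K] trivial. *)
Lemma Bpsi_schmidt_lt (K : {group gT}) :
  Bpsi_group G -> K \proper Q -> (psi P * psi K)%N < #|G|.
Proof.
move=> BpsiG prK; have sKQ := proper_sub prK.
have coPK : coprime #|P| #|K| by apply: coprimegS sKQ coPQ.
have nPK := subset_trans sKQ nPQ.
have prH : P <*> K \proper G.
  rewrite properEcard join_subG sPG (subset_trans sKQ sQG) /=.
  rewrite norm_joinEr // coprime_cardMg // -(sdprod_card defG).
  by rewrite ltn_pmul2l ?cardG_gt0 // proper_card.
have cPK : K \subset 'C(P).
  by apply: (sub_nilpotent_cent2 (nilH prH)); rewrite ?joing_subl ?joing_subr.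
by rewrite -(psi_dprod (dprodEY cPK (coprime_TIg coPK)) coPK); apply: BpsiG.
Qed.

Lemma schmidt_cards (alpha beta : nat) :
    #|G| = (p ^ alpha * q ^ beta)%N ->
  #|P| = (p ^ alpha)%N /\ #|Q| = (q ^ beta)%N.
Proof.
move=> oG; rewrite (card_Hall sylP) (card_Hall sylQ) oG.
rewrite !partnM ?expn_gt0 ?prime_gt0 //.
have pn m : p.-nat (p ^ m)%N by rewrite pnatX pnat_id.
have qn m : q.-nat (q ^ m)%N by rewrite pnatX pnat_id.
have p'q m : p^'.-nat (q ^ m)%N by rewrite (pi_pnat (qn m)) // !inE eq_sym.
have q'p m : q^'.-nat (p ^ m)%N by rewrite (pi_pnat (pn m)) // !inE.
rewrite (part_pnat_id (pn _)) (part_pnat_id (qn _)).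
by rewrite (part_p'nat (p'q _)) (part_p'nat (q'p _)) muln1 mul1n.
Qed.

Lemma Bpsi_schmidt_beta (alpha beta : nat) :
    Bpsi_group G -> #|G| = (p ^ alpha * q ^ beta)%N -> 1 <= alpha ->
    1 <= beta -> cyclic Q ->
  beta = 1%N.
Proof.
move=> BpsiG oG; have [oP oQ] := schmidt_cards oG.
case: beta oQ oG => [|[|b]] // oQ oG alpha_gt0 _ cQ.
have [y defQ] := cyclicP cQ.
have oK : #|<[y ^+ q]>| = (q ^ b.+1)%N.
  rewrite -[X in y ^+ X]expn1 -/(order _).
  by rewrite (@orderXexp _ q 1 b.+2) ?subn1 // -oQ defQ.
have prK : <[y ^+ q]> \proper Q.
  rewrite properEcard oK oQ ltn_exp2l ?prime_gt1 // ltnSn andbT.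
  by rewrite defQ cycleX.
have := Bpsi_schmidt_lt BpsiG prK.
have := psi_cyclic_pgroup_ge q_pr (cycle_cyclic _) oK.
have := psi_pgroup_ge p_pr pP.
have : 1 < #|P| by rewrite cardG_gt1 schmidt_neq1.
rewrite -(sdprod_card defG) oQ oK [(q ^ b.+2)%N]expnSr.
have := prime_gt1 p_pr; move: #|P| (psi _) (psi _) (q ^ b.+1 * q)%N => a k x z.
move=> p_gt1 a_gt1 le_ax le_zk lt_xz; exfalso.
(* Since [p] and [#|P|] are at least 2, 1 + [p]([#|P|] - 1) is at least (3/2)[#|P|]. With the 2/3
   bound for [<[y ^+ q]>], the product of the two sums reaches [#|G|]. *)
have le_3a : 3 * a <= 2 * x.
  apply: leq_trans (leq_mul (leqnn 2) le_ax).
  by apply: leq_trans (_ : 2 * (1 + 2 * a.-1) <= _); nia.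
by nia.
Qed.

Lemma schmidt_Bpsi :
    #|Q| = q -> psi P < #|G| -> (psi 'C_P(Q) * psi Q)%N < #|G| ->
  Bpsi_group G.
Proof.
move=> oQ ltP ltC H /(schmidt_psi_proper oQ)[/psi_subset le_HP | le_H].
  exact: leq_ltn_trans le_HP ltP.
exact: leq_ltn_trans le_H ltC.
Qed.

End Schmidt.

(** * The order of [p] modulo [q] and the size of the centraliser *)

Lemma dvdn_prim_root_Fp (p q r m n : nat) :
    prime p -> prime q -> p != q -> (r.-primitive_root (p%:R : 'F_q))%R ->
  m <= n -> q %| p ^ n - p ^ m -> r %| n - m.
Proof.
move=> p_pr q_pr neq_pq prim_r le_mn.
have -> : p ^ n - p ^ m = p ^ m * (p ^ (n - m) - 1).
  by rewrite mulnBr muln1 -expnD subnKC.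
rewrite Gauss_dvdr; last first.
  by rewrite coprimeXr // prime_coprime // dvdn_prime2 // eq_sym.
rewrite -eqn_mod_dvd ?expn_gt0 ?prime_gt0 // => /eqP eq_mod.
rewrite (prim_order_dvd prim_r) -GRing.natrX -(Fp_nat_mod q_pr) eq_mod.
by rewrite Fp_nat_mod.
Qed.

(** Let ['C_P(Q)] have order [p ^ k]. Then [k < alpha] as [Q] acts nontrivially, and [r] divides the
    positive number [alpha - k], so [k <= alpha - r]. The centraliser is elementary abelian, so its
    order determines its sum. *)
Lemma schmidt_subcent_bound (gT : finGroupType) (G P Q : {group gT})
    (p q alpha r : nat) :
    prime p -> prime q -> p != q -> schmidt_sdprod p q G P Q ->
    #|G| = p ^ alpha * q -> (r.-primitive_root (p%:R : 'F_q))%R ->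
  r <= alpha /\ psi 'C_P(Q)%g <= 1 + p * (p ^ (alpha - r)).-1.
Proof.
move=> p_pr q_pr neq_pq schG oG prim_r.
have oGq : #|G| = p ^ alpha * q ^ 1 by rewrite expn1.
have [oP _] := schmidt_cards p_pr q_pr neq_pq schG oGq.
have abC := schmidt_subcent_abelem neq_pq schG.
have [k oC] := p_natP (abelem_pgroup abC).
have lt_k : k < alpha.
  rewrite -(ltn_exp2l _ _ (prime_gt1 p_pr)) -oC -oP.
  exact: proper_card (schmidt_subcent_proper schG).
have r_dvd : r %| alpha - k.
  apply: (dvdn_prim_root_Fp p_pr q_pr neq_pq prim_r (ltnW lt_k)).
  by rewrite -oP -oC (schmidt_card_mod schG).
have le_r : r <= alpha - k by rewrite dvdn_leq // subn_gt0.
split; first by lia.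
rewrite (@psi_prime_exponent _ p) //; last by case/and3P: abC.
rewrite leq_add2l leq_mul2l /= oC; apply/orP; right.
by rewrite -!subn1 leq_sub2r // leq_pexp2l ?prime_gt0 //; lia.
Qed.

(** The two natural factors are [p]^([alpha] - [r] + 1) - [p] + 1 and [q]^2 - [q] + 1 written
    without a truncating difference; [r <= alpha] makes the integer exponent a natural number. *)
Lemma psi_bound_of_rat (p q alpha r : nat) :
    0 < p -> 0 < q -> r <= alpha ->
    (((p%:R : rat) ^ (alpha%:Z - r%:Z + 1) - p%:R + 1)
       * (q%:R ^+ 2 - q%:R + 1) < p%:R ^+ alpha * q%:R)%R ->
  (1 + p * (p ^ (alpha - r)).-1) * (1 + q * q.-1) < p ^ alpha * q.
Proof.
move=> p_gt0 q_gt0 le_r; rewrite -(Num.Theory.ltr_nat rat).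
have -> : (alpha%:Z - r%:Z + 1 = (alpha - r).+1%:Z)%R by lia.
rewrite -exprnP !GRing.natrM !GRing.natrD !GRing.natrM GRing.natrX.
have -> : ((p ^ (alpha - r)).-1%:R = (p%:R : rat) ^+ (alpha - r) - 1)%R.
  by rewrite -subn1 GRing.natrB ?expn_gt0 ?p_gt0 // GRing.natrX.
have -> : (q.-1%:R = (q%:R : rat) - 1)%R by rewrite -subn1 GRing.natrB.
congr (_ < _)%R; rewrite GRing.exprS; ring.
Qed.

Theorem theorem2p7 :
  (forall (gT : finGroupType) (G P Q : {group gT}) (p q alpha beta : nat),
     prime p -> prime q -> p != q -> 1 <= alpha -> 1 <= beta ->
     schmidt_sdprod p q G P Q -> #|G| = p ^ alpha * q ^ beta ->
     Bpsi_group G ->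
     [/\ special_pgroup p P, #|P| = p ^ alpha,
         (Q \isog Zp q)%g, beta = 1 & p < q])
  /\
  (forall (gT : finGroupType) (G P Q : {group gT}) (p q alpha r : nat),
     prime p -> prime q -> p < q -> 1 <= alpha ->
     schmidt_sdprod p q G P Q -> #|G| = p ^ alpha * q ->
     special_pgroup p P -> (Q \isog Zp q)%g ->
     (* r is the multiplicative order of p modulo q *)
     (r.-primitive_root (p%:R : 'F_q))%R ->
     [/\ abelian P -> Bpsi_group G,
         ~~ abelian P -> odd p ->
         (((p%:R : rat) ^ (alpha%:Z - r%:Z + 1) - p%:R + 1)
            * (q%:R ^+ 2 - q%:R + 1) < p%:R ^+ alpha * q%:R)%R ->
         Bpsi_group G
       & ~~ abelian P -> p = 2 ->
         (((p%:R : rat) ^ (alpha%:Z - r%:Z + 1) - p%:R + 1)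
            * (q%:R ^+ 2 - q%:R + 1) < p%:R ^+ alpha * q%:R)%R ->
         psi P < 2 ^ alpha * q ->
         Bpsi_group G]).
Proof.
split=> [gT G P Q p q alpha beta p_pr q_pr neq_pq a_gt0 b_gt0 schG oG BpsiG
        |gT G P Q p q alpha r p_pr q_pr lt_pq a_gt0 schG oG _ _ prim_r].
- have cQ : cyclic Q by case: schG => _ _ [].
  have [oP oQ] := schmidt_cards p_pr q_pr neq_pq schG oG.
  have b1 := Bpsi_schmidt_beta p_pr q_pr neq_pq schG BpsiG oG a_gt0 b_gt0 cQ.
  rewrite b1 expn1 in oQ oG.
  split=> //; first exact: (schmidt_special neq_pq schG).
    have oZ := card_Zp (prime_gt0 q_pr).
    by rewrite isog_cyclic_card // oZ oQ eqxx prime_cyclic ?oZ.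
  have pr1 : 1%G \proper Q by rewrite proper1G -cardG_gt1 oQ prime_gt1.
  have := Bpsi_schmidt_lt neq_pq schG BpsiG pr1.
  rewrite [psi 1%G]/psi big_set1 order1 muln1 oG => lt_psi.
  have pP : (p.-group P)%g by case: schG => _ [/pHall_pgroup].
  have := leq_ltn_trans (psi_pgroup_ge p_pr pP) lt_psi.
  (* If [q < p], then 1 + [p](a - 1) < a[q] with a = [p ^ alpha] would force a < [q], against [p] <=
     a. *)
  have : p <= #|P| by rewrite dvdn_leq // oP dvdn_exp.
  rewrite oP [p < q]ltn_neqAle neq_pq /=; move: (p ^ alpha) => a.
  have := prime_gt0 p_pr; nia.
have neq_pq : p != q by rewrite neq_ltn lt_pq.
have oGq : #|G| = p ^ alpha * q ^ 1 by rewrite expn1.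
have [oP] := schmidt_cards p_pr q_pr neq_pq schG oGq; rewrite expn1 => oQ.
have psiQ : psi Q = 1 + q * q.-1.
  by rewrite (@psi_prime_exponent _ q) ?oQ // -oQ exponent_dvdn.
(* This serves both the abelian and the odd case: 1 + [p](a - 1) < a[p] < a[q], where a =
   [p ^ alpha]. *)
have psiP : exponent P %| p -> psi P < #|G|.
  move/(psi_prime_exponent p_pr)->; rewrite oP oG.
  have : 0 < p ^ alpha by rewrite expn_gt0 prime_gt0.
  have := prime_gt1 p_pr; move: (p ^ alpha) => a; nia.
have [le_r psiC] := schmidt_subcent_bound p_pr q_pr neq_pq schG oG prim_r.
have psiCQ : (((p%:R : rat) ^ (alpha%:Z - r%:Z + 1) - p%:R + 1)
    * (q%:R ^+ 2 - q%:R + 1) < p%:R ^+ alpha * q%:R)%R ->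
    psi 'C_P(Q)%g * psi Q < #|G|.
  move=> lt_rat; rewrite psiQ oG.
  apply: leq_ltn_trans (leq_mul psiC (leqnn _)) _.
  by apply: psi_bound_of_rat; rewrite ?prime_gt0.
have BpsiG := schmidt_Bpsi q_pr neq_pq schG oQ.
split=> [abP | nabP p_odd /psiCQ | nabP p2 /psiCQ ltCQ ltP].
- apply: BpsiG.
    apply: psiP.
    by case/and3P: (schmidt_abelem neq_pq schG abP).
  (* Now ['C_P(Q)] is trivial, so [q] divides [p ^ alpha - 1]. Hence [q < p ^ alpha], and [psi Q] <
     ([q] + 1)[q] <= [#|G|]. *)
  have := schmidt_card_mod schG.
  rewrite (schmidt_abelian neq_pq schG abP) cards1.
  rewrite [psi 1%g]/psi big_set1 order1 mul1n psiQ oG oP.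
  have : 1 < p ^ alpha by rewrite -(expn0 p) ltn_exp2l // prime_gt1.
  move: (p ^ alpha) => a a_gt1 q_dvd.
  have lt_qa : q < a.
    have : q <= a - 1 by rewrite dvdn_leq // subn_gt0.
    lia.
  apply: leq_trans (_ : q.+1 * q <= _); last by rewrite leq_mul2r lt_qa orbT.
  by case: (q) (prime_gt0 q_pr) => // m _ /=; lia.
- by apply: BpsiG; apply/psiP/(schmidt_odd_exponent p_pr neq_pq schG).
- by apply: BpsiG => //; rewrite oG p2.
Qed.
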